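(* Let $G$ be a connected graph that contains a cycle, and let $n(G)=|V(G)|$. Then $\mathrm{dom}_t(G)=n(G)-1$ if and only if $G$ belongs to the family $\mathcal{F}$ or $G$ is isomorphic to one of $K_4$, $K_{2,3}$, $K_4-e$.
   Context: All graphs are finite and simple. An orientation of a graph $G$ is a digraph obtained by directing each edge $uv$ of $G$ in exactly one of the two directions $(u,v)$ or $(v,u)$. The orientation is valid if every vertex has in-degree at least $1$. A set $S\subseteq V(D)$ is a total dominating set of a digraph $D$ if every vertex of $D$ (including those in $S$) has an in-neighbor in $S$; $\gamma_t(D)$ is the minimum cardinality of a total dominating set of $D$. For a graph $G$ in which every component contains a cycle (equivalently, $G$ has a valid orientation), $\mathrm{dom}_t(G)$ is the minimum of $\gamma_t(D)$ over all valid orientations $D$ of $G$. The family $\mathcal{F}$: a graph $G$ is in $\mathcal{F}$ if and only if $G$ is obtained from a cycle $C_k$ on $k\ge 3$ vertices and a path $P_\ell$ on $\ell\ge 2$ vertices (disjoint from it) by identifying one of the leaves (end-vertices) of the path with an arbitrary vertex of the cycle. $K_4-e$ is the complete graph on four vertices with one edge removed. *)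

(* Defs.v *)
From mathcomp Require Import all_boot.

Set Implicit Arguments.
Unset Strict Implicit.
Unset Printing Implicit Defensive.

(* A finite simple graph is a symmetric irreflexive relation [e] on a [finType];
   a digraph on [T] is its set of arcs, [(u, v)] being the arc from u to v. *)

Definition connected (T : finType) (e : rel T) : Prop :=
  0 < #|T| /\ forall x y : T, connect e x y.

Definition contains_cycle (T : finType) (e : rel T) : Prop :=
  exists c : seq T, [/\ 2 < size c, uniq c & cycle e c].

Section TotalDomination.
Variable T : finType.
Implicit Types (e : rel T) (D : {set T * T}) (S : {set T}).

(* For u = v the two clauses together exclude loops. *)
Definition orientation e D : bool :=
  [forall u, forall v,
     (e u v == ((u, v) \in D) || ((v, u) \in D))
     && ~~ (((u, v) \in D) && ((v, u) \in D))].

Definition valid_orientation e D : bool :=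
  orientation e D && [forall v, 0 < #|[set u | (u, v) \in D]|].

Definition total_dominating D S : bool :=
  [forall v, [exists u in S, (u, v) \in D]].

(* The initial value #|T| never changes the minimum when some total dominating
   set exists, since #|S| <= #|T|. *)
Definition gamma_t D : nat :=
  \big[minn/#|T|]_(S : {set T} | total_dominating D S) #|S|.

(* Likewise gamma_t D <= #|T|, so this is the true minimum as soon as e has a
   valid orientation. *)
Definition dom_t e : nat :=
  \big[minn/#|T|]_(D : {set T * T} | valid_orientation e D) gamma_t D.

End TotalDomination.

Definition graph_iso (T1 T2 : finType) (e1 : rel T1) (e2 : rel T2) : Prop :=
  exists2 f : T1 -> T2, bijective f & forall x y, e2 (f x) (f y) = e1 x y.

Definition cycle_graph (k : nat) : rel 'I_k :=
  fun i j => (j == ordS i) || (i == ordS j).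
Arguments cycle_graph : clear implicits.

Definition path_graph (l : nat) : rel 'I_l :=
  fun i j => (j == i.+1 :> nat) || (i == j.+1 :> nat).
Arguments path_graph : clear implicits.

Definition leaf (T : finType) (e : rel T) (x : T) : bool :=
  #|[set y | e x y]| == 1.

(* The disjoint union of two graphs with the vertex b of the second identified
   with the vertex a of the first: [inl a] plays the role of b. *)
Definition identify (T1 T2 : finType) (e1 : rel T1) (e2 : rel T2)
    (a : T1) (b : T2) : rel (T1 + {y : T2 | y != b}) :=
  fun u v =>
    match u, v with
    | inl x, inl x' => e1 x x'
    | inr y, inr y' => e2 (val y) (val y')
    | inl x, inr y => (x == a) && e2 b (val y)
    | inr y, inl x => (x == a) && e2 (val y) b
    end.
Arguments identify {T1 T2} e1 e2 a b _ _.

Definition in_family_F (T : finType) (e : rel T) : Prop :=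
  exists (k l : nat) (a : 'I_k) (b : 'I_l),
    [/\ 3 <= k, 2 <= l, leaf (path_graph l) b
      & graph_iso e (identify (cycle_graph k) (path_graph l) a b)].

Definition complete_graph (n : nat) : rel 'I_n := fun x y => x != y.
Arguments complete_graph : clear implicits.

Definition complete_bipartite (m n : nat) : rel ('I_m + 'I_n) :=
  fun u v =>
    match u, v with
    | inl _, inr _ | inr _, inl _ => true
    | _, _ => false
    end.
Arguments complete_bipartite : clear implicits.

Definition remove_edge (T : finType) (e : rel T) (a b : T) : rel T :=
  fun x y => e x y && ([set x; y] != [set a; b]).

Definition K4_minus_edge : rel 'I_4 :=
  remove_edge (complete_graph 4) ord0 ord_max.

(* Main.v *)
Require Import Defs.
From mathcomp Require Import all_boot.
From mathcomp Require Import zify.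

Set Implicit Arguments.
Unset Strict Implicit.
Unset Printing Implicit Defensive.

(** An orientation dominated by [S] amounts to choosing, for every vertex [v], an
    in-neighbour [p v] in [S]. Conversely a function [p] with [p v] adjacent to [v]
    and [p (p v) != v], called a selector below, extends to a valid orientation
    dominated by its image. So [dom_t e] is the least size of the image of a
    selector ([dom_t_leq], [dom_t_attained]), and [dom_t e = #|T| - 1] says that
    every selector misses at most one vertex and some selector misses one.

    Suppose this holds, and let [p] miss exactly [x]; then exactly one pair of
    vertices has a common image under [p]. An edge not used by [p] is spare, and
    redirecting either of its ends to the other gives a new selector. Applied to
    every spare edge, this move must never produce two missed vertices, which is
    so restrictive that the graph can be read off. If there is no spare edge, the
    graph is the graph of the function [p], whose only orbit is a tail running
    into a cycle ([functional_family]). If some selector is a permutation and has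
    a spare edge, the graph is a 4-cycle with one or two chords
    ([bijective_selector]). Otherwise the spare edges all start at [x], two more
    moves show that there is only one of them, and the graph is the union of the
    two 4-cycles so obtained, sharing a path of length two ([spare_selector]).

    Conversely, in the graph of a function [q] every edge has to be used by every
    selector, so that every image contains that of [q] ([functional_image]); for a
    cycle with a pendant path, [q] misses only the free end ([dom_t_identify]).
    For the three exceptional graphs, iterating a selector from any vertex gives
    at least three dominating vertices, and at least four if the graph is
    bipartite. *)

(** * Minima over finite families, cyclic shifts *)

Lemma bigmin_leq (I : finType) (P : pred I) (F : I -> nat) m i :
  P i -> \big[minn/m]_(j | P j) F j <= F i.
Proof.
move=> Pi; have: i \in index_enum I by rewrite mem_index_enum.
elim: (index_enum I) => // j r IHr; rewrite in_cons big_cons.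
case/predU1P => [<-|/IHr le_r]; first by rewrite Pi geq_minl.
by case: ifP => // _; apply: leq_trans le_r; exact: geq_minr.
Qed.

Lemma bigmin_leq_init (I : finType) (P : pred I) (F : I -> nat) m :
  \big[minn/m]_(j | P j) F j <= m.
Proof.
elim/big_rec: _ => // j x _ le_x; apply: leq_trans le_x; exact: geq_minr.
Qed.

Lemma bigmin_attained (I : finType) (P : pred I) (F : I -> nat) m :
    \big[minn/m]_(j | P j) F j < m ->
  exists2 i, P i & F i <= \big[minn/m]_(j | P j) F j.
Proof.
elim/big_rec: _ => [|i x Pi IHx]; first by rewrite ltnn.
by rewrite /minn; case: (ltnP (F i) x) => [_ _|_ /IHx //]; exists i.
Qed.

Lemma val_ordS l (i : 'I_l) : val (ordS i) = if i.+1 == l then 0 else i.+1.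
Proof.
rewrite /=; case: eqP => [->|il]; first by rewrite modnn.
by rewrite modn_small //; have := ltn_ord i; lia.
Qed.

Lemma val_ord_pred l (i : 'I_l) :
  val (ord_pred i) = if i == 0 :> nat then l.-1 else i.-1.
Proof.
have := ltn_ord i; rewrite /=; case: eqP => [->|i0] il.
  by rewrite add0n modn_small //; lia.
have -> : (i + l).-1 = i.-1 + l by lia.
by rewrite modnDr modn_small //; lia.
Qed.

(** * Selectors and spare edges *)

(** A vertex [v] is to be dominated through the arc from [p v] to [v]; the second
    clause keeps the edge joining them from being directed both ways. *)
Definition selector (T : finType) (e : rel T) (p : T -> T) : Prop :=
  forall v, e (p v) v /\ p (p v) != v.

(** The edges that no arc chosen by [p] uses, so that they may still be directed
    either way. *)
Definition spare (T : finType) (e : rel T) (p : T -> T) (u v : T) : bool :=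
  [&& e u v, p u != v & p v != u].

Definition redirect (T : finType) (p : T -> T) (v u : T) : T -> T :=
  fun w => if w == v then u else p w.

Definition missed (T : finType) (p : T -> T) (x : T) : Prop :=
  forall w, p w != x.

(** No selector misses two vertices, that is [#|T| - 1 <= dom_t e]. *)
Definition tight (T : finType) (e : rel T) : Prop :=
  forall p, selector e p -> #|T| <= #|p @: setT|.+1.

(** When [q] is a selector, these are the graphs all of whose components are
    unicyclic: [q] runs around each cycle and, on the trees attached to it,
    towards it. *)
Definition functional (T : finType) (e : rel T) (q : T -> T) : Prop :=
  forall u v, e u v = (q u == v) || (q v == u).

Lemma missedP (T : finType) (p : T -> T) x :
  missed p x <-> x \notin p @: setT.
Proof.
split=> [px|/imsetP px w].
  by apply/imsetP => -[w _ /eqP]; rewrite eq_sym (negPf (px w)).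
by apply/eqP => pw; apply: px; exists w.
Qed.

Lemma missed_redirect (T : finType) (p : T -> T) v u x :
  missed p x -> u != x -> missed (redirect p v u) x.
Proof. by move=> px ux w; rewrite /redirect; case: (eqVneq w v). Qed.

(** * Recognising a graph from an enumeration of its vertices *)

(** The vertices of [T] are listed in [s], and [idx] tells which entry of [s]
    plays the role of a given vertex of the model graph. *)
Lemma graph_iso_seq (T T2 : finType) (e : rel T) (e2 : rel T2) x0 (s : seq T)
    (idx : T2 -> nat) :
    uniq s -> (forall y, y \in s) -> injective idx ->
    (forall z, idx z < size s) -> size s <= #|T2| ->
    (forall y z, e (nth x0 s (idx y)) (nth x0 s (idx z)) = e2 y z) ->
  graph_iso e e2.
Proof.
move=> uniq_s sT inj_idx lt_idx le_s eE; pose g y := nth x0 s (idx y).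
have inj_g : injective g.
  by move=> y z /eqP; rewrite nth_uniq // => /eqP/inj_idx.
have le_T : #|T| <= #|T2|.
  apply: leq_trans le_s; rewrite -(card_uniqP uniq_s).
  by apply/subset_leq_card/subsetP => y _.
have [h gK hK] := inj_card_bij inj_g le_T.
by exists h => [|x y]; [exists g | rewrite -eE -/(g _) -/(g _) !hK].
Qed.

Lemma graph_iso_ord (T : finType) (e : rel T) n (e2 : rel 'I_n) x0 (s : seq T) :
    uniq s -> (forall y, y \in s) -> size s = n ->
    (forall i j : 'I_n, e (nth x0 s i) (nth x0 s j) = e2 i j) ->
  graph_iso e e2.
Proof.
move=> uniq_s sT sz_s eE; apply: graph_iso_seq (val_inj) _ _ eE => //.
  by move=> i; rewrite sz_s ltn_ord.
by rewrite card_ord sz_s.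
Qed.

Lemma set2_eq (T : finType) (x y a b : T) :
  ([set x; y] == [set a; b]) = (x == a) && (y == b) || (x == b) && (y == a).
Proof.
apply/eqP/orP => [xyE|[] /andP[/eqP-> /eqP->] //]; last exact: setUC.
have : x \in [set a; b] by rewrite -xyE set21.
have : y \in [set a; b] by rewrite -xyE set22.
have : a \in [set x; y] by rewrite xyE set21.
have : b \in [set x; y] by rewrite xyE set22.
rewrite !inE; do ![case: eqVneq => //= ?; subst]; by [left | right].
Qed.

Lemma K4_minus_edgeE (i j : 'I_4) :
  K4_minus_edge i j =
  (i != j :> nat) && ~~ ((i == 0 :> nat) && (j == 3 :> nat)
                      || (i == 3 :> nat) && (j == 0 :> nat)).
Proof. by rewrite /K4_minus_edge /remove_edge /complete_graph set2_eq. Qed.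

(** * Total domination of orientations through selectors *)

Section Selectors.

Variables (T : finType) (e : rel T).
Hypotheses (e_sym : symmetric e) (e_irr : irreflexive e).
Implicit Types (p q : T -> T) (u v w x y : T).

Lemma edge_neq u v : e u v -> u != v.
Proof. by move=> euv; apply/eqP => uv; move: euv; rewrite uv e_irr. Qed.

(** The arcs [(p v, v)] form part of a valid orientation, completed arbitrarily
    (here along [enum_rank]), in which the image of [p] is total dominating. *)
Lemma dom_t_leq p : selector e p -> dom_t e <= #|p @: setT|.
Proof.
move=> sel_p.
pose D := [set a : T * T | e a.1 a.2 &&
  ((p a.2 == a.1) || (p a.1 != a.2) && (enum_rank a.1 < enum_rank a.2))].
have arcD v : (p v, v) \in D by rewrite inE /= eqxx (sel_p v).1.
have orD : valid_orientation e D.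
  apply/andP; split; last first.
    by apply/forallP => v; apply/card_gt0P; exists (p v); rewrite inE.
  apply/forallP => u; apply/forallP => v; rewrite !inE /= (e_sym v u).
  case euv: (e u v) => //=.
  have uv := edge_neq euv.
  have neq_rank : (enum_rank u != enum_rank v :> nat).
    by apply: contra uv => /eqP/val_inj/enum_rank_inj ->.
  have [pv|_] := eqVneq (p v) u; have [pu|_] := eqVneq (p u) v => //=.
    by have := (sel_p u).2; rewrite pu pv eqxx.
  by case: ltngtP neq_rank.
have domS : total_dominating D (p @: setT).
  by apply/forallP => v; apply/existsP; exists (p v); rewrite imset_f ?arcD.
apply: leq_trans (@bigmin_leq _ _ (@gamma_t T) _ D orD) _.
exact: (@bigmin_leq _ _ (fun S : {set T} => #|S|) _ _ domS).
Qed.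

(** In an optimal orientation, let [p v] be an in-neighbour of [v] in an optimal
    total dominating set. *)
Lemma dom_t_attained :
  dom_t e < #|T| -> exists2 p, selector e p & #|p @: setT| <= dom_t e.
Proof.
move=> lt_dom; have [D /andP[/forallP orD _] le_gD] := bigmin_attained lt_dom.
have lt_g := leq_ltn_trans le_gD lt_dom.
have [S /forallP domS le_SD] := bigmin_attained lt_g.
have [p pP] : exists p : T -> T, forall v, (p v \in S) && ((p v, v) \in D).
  apply: (@fin_all_exists T (fun=> T) (fun v u => (u \in S) && ((u, v) \in D))).
  by move=> v; have /existsP[u uP] := domS v; exists u.
exists p => [v|].
  have /andP[_ pv] := pP v; have /forallP/(_ v)/andP[/eqP-> _] := orD (p v).
  split; first by rewrite pv.
  apply/eqP => ppv; have /andP[_ ppv'] := pP (p v).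
  have /forallP/(_ v)/andP[_] := orD (p v).
  by rewrite pv -{1}ppv ppv'.
apply: leq_trans (leq_trans le_SD le_gD); apply/subset_leq_card/subsetP.
by move=> _ /imsetP[v _ ->]; have /andP[] := pP v.
Qed.

Lemma dom_t_geq m :
    m <= #|T| -> (forall p, selector e p -> m <= #|p @: setT|) ->
  m <= dom_t e.
Proof.
move=> le_mT le_m; rewrite leqNgt; apply/negP => lt_m.
have [p /le_m le_mp le_p] := dom_t_attained (leq_trans lt_m le_mT).
by have := leq_ltn_trans (leq_trans le_mp le_p) lt_m; rewrite ltnn.
Qed.

(** The only local move used on selectors. Since the edge [uv] is spare, it is not
    already directed from [v] to [u], so directing it from [u] to [v] creates no
    conflict. *)
Lemma selector_redirect p u v :
  selector e p -> spare e p u v -> selector e (redirect p v u).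
Proof.
move=> sel_p /and3P[euv pu pv] w; rewrite /redirect.
have uv := edge_neq euv.
case: (eqVneq w v) => [->|wv]; first by rewrite (negPf uv).
have [ew pw] := sel_p w; split=> //; case: (eqVneq (p w) v) => // pwv.
by apply: contra pu => /eqP->; rewrite pwv.
Qed.

Lemma spare_sym p u v : spare e p u v = spare e p v u.
Proof. by rewrite /spare e_sym [X in _ && X]andbC. Qed.

Lemma closed_setT (A : {set T}) x :
    (forall x y, connect e x y) -> x \in A ->
    (forall u v, u \in A -> e u v -> v \in A) ->
  forall y, y \in A.
Proof.
move=> conn xA clA y; have /connectP[s] := conn x y.
elim: s x xA => [|z s IHs] x xA /=; first by move=> _ ->.
by case/andP => /(clA _ _ xA) zA; exact: IHs.
Qed.

End Selectors.

(** * Graphs in which no selector misses two vertices *)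

Section Tight.

Variables (T : finType) (e : rel T).
Hypotheses (e_sym : symmetric e) (e_irr : irreflexive e) (e_tight : tight e).
Implicit Types (p q : T -> T) (u v w x y : T).

Lemma missed_uniq p x y : selector e p -> missed p x -> missed p y -> x = y.
Proof.
move=> /e_tight le_p /missedP px /missedP py; apply/eqP/contraT => xy.
have: #|[set x; y]| <= #|~: (p @: setT)|.
  by apply/subset_leq_card/subsetP => z /set2P[]->; rewrite inE.
by rewrite cards2 xy cardsCs setCK; lia.
Qed.

(** The image of [p] has at least [#|T| - 1] elements, so dropping [a], or
    dropping [b], makes [p] injective: no other pair can collide. *)
Lemma collision_uniq p a b u v :
    selector e p -> p a = p b -> a != b -> p u = p v -> u != v ->
  (u = a /\ v = b) \/ (u = b /\ v = a).
Proof.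
move=> /e_tight le_p.
have injp c d : p c = p d -> c != d -> {in [set~ c] &, injective p}.
  move=> pcd cd; apply/imset_injP; rewrite eqn_leq leq_imset_card cardsC1.
  have -> : p @: [set~ c] = p @: setT; last by lia.
  apply/eqP; rewrite eqEsubset imsetS ?subsetT //=.
  apply/subsetP => _ /imsetP[w _ ->]; have [->|wc] := eqVneq w c.
    by rewrite pcd imset_f // !inE eq_sym.
  by rewrite imset_f // !inE.
move=> pab ab puv uv; have ia := injp _ _ pab ab.
have ba : b != a by rewrite eq_sym.
have ib := injp _ _ (esym pab) ba.
have [ua|ua] := eqVneq u a.
  subst u; left; split=> //; have [//|vb] := eqVneq v b.
  by case/eqP: uv; apply: ib; rewrite ?inE.
have va : v = a.
  have [//|va] := eqVneq v a; by case/eqP: uv; apply: ia; rewrite ?inE.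
right; split=> //; have [//|ub] := eqVneq u b.
by case/eqP: uv; apply: ib; rewrite ?inE // va.
Qed.

(** Moving one of the two colliding vertices onto the missed vertex turns the
    selector into a permutation. *)
Lemma redirect_inj p a c x :
    selector e p -> p a = p c -> a != c -> missed p x ->
  injective (redirect p c x).
Proof.
move=> sel_p pac ac px u v; rewrite /redirect.
case: (eqVneq u c) => [->|uc]; case: (eqVneq v c) => [->|vc] // /eqP.
- by rewrite eq_sym (negPf (px v)).
- by rewrite (negPf (px u)).
move=> /eqP puv; apply/eqP/contraT => uv.
by have [[_ /eqP]|[/eqP]] := collision_uniq sel_p pac ac puv uv;
  rewrite ?(negPf uc) ?(negPf vc).
Qed.

(** Redirecting [v] to [u] leaves [x] missed; if [v] were the only preimage of
    [p v], then [p v] would be missed as well. *)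
Lemma spare_collides p x u v :
    selector e p -> missed p x -> spare e p u v -> u != x ->
  exists2 w, w != v & p w = p v.
Proof.
move=> sel_p px sp ux; have sel_q := selector_redirect e_irr sel_p sp.
have qx := missed_redirect v px ux.
have [w /andP[wv /eqP pw]|nw] := pickP [pred w | (w != v) && (p w == p v)].
  by exists w.
case/and3P: sp => _ _ pv.
have qpv : missed (redirect p v u) (p v).
  move=> w; rewrite /redirect; case: (eqVneq w v) => [_|wv].
    by rewrite eq_sym.
  by have := nw w; rewrite /= wv /= => ->.
by have := px v; rewrite (missed_uniq sel_q qpv qx) eqxx.
Qed.

(** A spare edge [uv] avoiding [x] would join two vertices with a common image
    [c]. After redirecting [u] to [v] the edge [uc] is spare and still avoids
    [x], so its ends have a common image, which gives [v = p (p v)]. *)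
Lemma spare_touches_missed p x u v :
    selector e p -> missed p x -> spare e p u v ->
  u = x \/ v = x.
Proof.
move=> sel_p px sp; have [|ux] := eqVneq u x; first by left.
have [|vx] := eqVneq v x; first by right.
have same q a b : selector e q -> missed q x -> spare e q a b -> a != x ->
    b != x -> q a = q b.
  move=> sel_q qx sq ax bx; have ab := edge_neq e_irr (proj1 (andP sq)).
  have [w wb qw] := spare_collides sel_q qx sq ax.
  have [w' wa qw'] : exists2 w', w' != a & q w' = q a.
    by apply: (@spare_collides q x b a) => //; rewrite spare_sym.
  have [[_ ba]|[_ ->]] := collision_uniq sel_q qw wb qw' wa; last by [].
  by rewrite ba eqxx in ab.
have puv := same _ _ _ sel_p px sp ux vx.
have [euv pu pv] := and3P sp.
have sp' : spare e p v u by rewrite spare_sym.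
have sel_q := selector_redirect e_irr sel_p sp'.
have qx := missed_redirect u px vx.
have [epu ppu] := sel_p u; have upu := edge_neq e_irr epu.
have sq : spare e (redirect p u v) u (p u).
  rewrite /spare /redirect e_sym epu eqxx (negPf upu) ppu andbT /= eq_sym //.
have := same _ _ _ sel_q qx sq ux (px u).
rewrite /redirect eqxx (negPf upu) puv => vE.
by have := (sel_p v).2; rewrite -vE eqxx.
Qed.

Hypothesis e_conn : forall x y, connect e x y.

(** A permutation is a disjoint union of directed cycles. Using the edge [ab] at
    [b], and then the freed edge from [b] to [p b] at [p b], misses both [p b] and
    [p (p b)] unless [a = p (p b)]. So every spare edge is a chord at distance two
    in both directions around its cycle, which is then a 4-cycle, and there is no
    edge leaving it. *)
Lemma bijective_selector p u v :
    selector e p -> injective p -> spare e p u v ->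
  graph_iso e (complete_graph 4) \/ graph_iso e K4_minus_edge.
Proof.
move=> sel_p inj_p sp_uv.
have far a b : spare e p a b -> a = p (p b).
  move=> sp; have sel1 := selector_redirect e_irr sel_p sp.
  have [eab pa pb] := and3P sp; have [epb ppb] := sel_p b.
  have bpb : p b != b := edge_neq e_irr epb.
  have sp1 : spare e (redirect p b a) b (p b).
    by rewrite /spare /redirect e_sym epb eqxx (negPf bpb) ppb eq_sym pb.
  have sel2 := selector_redirect e_irr sel1 sp1.
  have [//|appb] := eqVneq a (p (p b)).
  have neq_pb : p (p b) != p b := edge_neq e_irr (sel_p (p b)).1.
  case/eqP: neq_pb; apply: (missed_uniq sel2).
    move=> w; rewrite /redirect; case: (eqVneq w (p b)) => [_|wpb].
      by rewrite eq_sym.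
    by case: (eqVneq w b) => // _; rewrite (inj_eq inj_p).
  move=> w; rewrite /redirect; case: (eqVneq w (p b)) => [_|_].
    by rewrite eq_sym.
  by case: (eqVneq w b) => [_|wb]; [rewrite eq_sym | rewrite (inj_eq inj_p)].
pose b := p v; pose c := p b; pose d := p c.
have uE : u = c := far _ _ sp_uv; subst u.
have vE : p d = v by rewrite (far v c) // (spare_sym e_sym).
have [evc _ _] := and3P sp_uv; rewrite e_sym in evc.
have ebv : e b v := (sel_p v).1; have ecb : e c b := (sel_p b).1.
have edc : e d c := (sel_p c).1.
have evd : e v d by rewrite -vE (sel_p d).1.
have bd : b != d by rewrite eq_sym (sel_p b).2.
pose s := [:: b; v; c; d].
have uniq_s : uniq s.
  by rewrite /= !inE !negb_or bd !(edge_neq e_irr) //= e_sym.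
have sT : forall y, y \in s.
  suff sP : forall y, y \in [set y in s] by move=> y; have := sP y; rewrite inE.
  have v_s : v \in [set y in s] by rewrite !inE eqxx orbT.
  apply: (closed_setT e_conn v_s) => y z ys eyz.
  have [<-|pyz] := eqVneq (p y) z.
    by move: ys; rewrite !inE => /or4P[] /eqP->; rewrite ?vE ?eqxx ?orbT.
  have [pzy|pzy] := eqVneq (p z) y.
    have [w ws yE] : exists2 w, w \in s & y = p w.
      move: ys; rewrite !inE => /or4P[] /eqP->;
      [exists v | exists d | exists b | exists c]; rewrite ?inE ?eqxx ?orbT //.
    by rewrite inE (inj_p _ _ (etrans pzy yE)).
  have -> : z = p (p y).
    by apply: far; rewrite (spare_sym e_sym) /spare eyz pyz pzy.
  by move: ys; rewrite !inE => /or4P[] /eqP->; rewrite ?vE ?eqxx ?orbT.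
have edges := (e_irr, ebv, ecb, edc, evd, evc,
  (e_sym v b, e_sym b c, e_sym c d, e_sym d v, e_sym c v, e_sym d b)).
case ebd: (e b d); [left | right].
  apply: (@graph_iso_ord _ _ _ _ v s) => //.
  move=> i j; rewrite /complete_graph -val_eqE /=.
  by case: i j => [[|[|[|[|//]]]] ?] [[|[|[|[|//]]]] ?] /=; rewrite ?edges ?ebd.
apply: (@graph_iso_ord _ _ _ _ v s) => //.
move=> i j; rewrite K4_minus_edgeE.
by case: i j => [[|[|[|[|//]]]] ?] [[|[|[|[|//]]]] ?] /=; rewrite ?edges ?ebd.
Qed.

(** Let [c := p x = p b]. By the previous lemmas every spare edge is of the form
    [xv]. If [v = b], redirecting [b] to [x] yields a permutation. Otherwise
    redirecting [v] to [x] shifts the missed vertex to [p v], and since the edge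
    from [v] to [p v] becomes spare, [p v] must collide: this forces [p v = b].
    Hence the spare edge is unique, say [xd], and [d -> b -> c <- x] under [p].

    Finally send [x] to [d] and [c] to [x]. The vertex missed is now [f := p c],
    unless [f = d], in which case a permutation is obtained. The edge [cf] is
    spare, so [f] collides, and this means [p f = d]. The vertices [c, d] and
    [f, b, x] are then the two sides of a complete bipartite graph, and no edge
    leaves them. *)
Lemma spare_selector p x u v :
    selector e p -> missed p x -> spare e p u v ->
  [\/ graph_iso e (complete_graph 4), graph_iso e (complete_bipartite 2 3)
    | graph_iso e K4_minus_edge].
Proof.
move=> sel_p px sp_uv.
have [v1 sp_xv1] : exists v, spare e p x v.
  have [<-|<-] := spare_touches_missed sel_p px sp_uv; first by exists v.
  by exists u; rewrite (spare_sym e_sym).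
have K4s q y z : selector e q -> injective q -> spare e q y z ->
    [\/ graph_iso e (complete_graph 4), graph_iso e (complete_bipartite 2 3)
      | graph_iso e K4_minus_edge].
  move=> sel_q inj_q sq.
  by case: (bijective_selector sel_q inj_q sq) => ?;
    [constructor 1 | constructor 3].
have spare_neq_x y : spare e p x y -> y != x.
  by case/andP => /(edge_neq e_irr); rewrite eq_sym.
have [b bx pb] : exists2 b, b != x & p b = p x.
  have sp' : spare e p v1 x by rewrite (spare_sym e_sym).
  exact: (spare_collides sel_p px sp' (spare_neq_x _ sp_xv1)).
have coll y z : p y = p z -> y != z -> (y = b /\ z = x) \/ (y = x /\ z = b).
  exact: (collision_uniq sel_p pb bx).
have p_neq y : p y != y := edge_neq e_irr (sel_p y).1.
have pp_neq y : p (p y) != y := (sel_p y).2.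
have [sp_xb|nsp_xb] := boolP (spare e p x b).
  apply: (K4s (redirect p b x) b (p b)).
  - exact: selector_redirect sp_xb.
  - by apply: redirect_inj (esym pb) _ px => //; rewrite eq_sym.
  rewrite /spare /redirect e_sym (sel_p b).1 eqxx (negPf (p_neq b)) pp_neq.
  by rewrite eq_sym px.
have spare_x y : spare e p x y -> p y = b.
  move=> sp; have yx := spare_neq_x y sp.
  have yb : y != b by apply: contra nsp_xb => /eqP <-.
  have sel_q := selector_redirect e_irr sel_p sp.
  have qpy : missed (redirect p y x) (p y).
    move=> w; rewrite /redirect; case: (eqVneq w y) => [_|wy].
      by rewrite eq_sym.
    apply/eqP => pwy; have [[_ /eqP]|[_ /eqP]] := coll _ _ pwy wy.
      by rewrite (negPf yx).
    by rewrite (negPf yb).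
  have sq : spare e (redirect p y x) y (p y).
    rewrite /spare /redirect e_sym (sel_p y).1 eqxx (negPf (p_neq y)) pp_neq.
    by rewrite eq_sym px.
  have ypy : y != p y by rewrite eq_sym.
  have [w wpy] := spare_collides sel_q qpy sq ypy.
  rewrite /redirect (negPf (p_neq y)); case: (eqVneq w y) => [_ /eqP|wy].
    by rewrite eq_sym (negPf (px _)).
  by move=> pw; have [[_ /eqP]|[]//] := coll _ _ pw wpy; rewrite (negPf (px _)).
have spare_x_uniq y z : spare e p x y -> spare e p x z -> y = z.
  move=> /spare_x py /spare_x pz; apply/eqP/contraT => yz.
  have [[yb _]|[_ zb]] := coll _ _ (etrans py (esym pz)) yz.
    by have := p_neq b; rewrite -{1}yb py eqxx.
  by have := p_neq b; rewrite -{1}zb pz eqxx.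
pose d := v1; pose c := p x; have pd : p d = b := spare_x d sp_xv1.
have cx : c != x by exact: px.
have dx : d != x := spare_neq_x d sp_xv1.
have dc : d != c.
  apply/eqP => dc; have := pp_neq d; rewrite pd pb -/c dc eqxx //.
(* Under [q] the vertices [d, b, c, x] form a directed 4-cycle. *)
pose q1 := redirect p x d; pose q := redirect q1 c x.
have sel_q1 : selector e q1.
  by apply: selector_redirect; rewrite // (spare_sym e_sym).
have q1x : missed q1 x by apply: missed_redirect.
have sp1 : spare e q1 x c.
  rewrite /spare /q1 /redirect e_sym (sel_p x).1 eqxx dc (negPf cx) /=.
  exact: px.
have sel_q : selector e q := selector_redirect e_irr sel_q1 sp1.
pose f := p c.
have fx : f != x := px c.
have fc : f != c := p_neq c.
have bc : b != c by rewrite eq_sym /c -pb.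
have qc : q c = x by rewrite /q /redirect eqxx.
have qx : q x = d by rewrite /q /q1 /redirect eq_sym (negPf cx) eqxx.
have qE w : w != c -> w != x -> q w = p w.
  by rewrite /q /q1 /redirect => /negPf-> /negPf->.
have sq : spare e q f c.
  by rewrite /spare qc qE // (sel_p c).1 pp_neq eq_sym fx.
have [fd|fd] := eqVneq f d.
  apply: K4s sel_q _ sq; apply: (@redirect_inj _ x) => //.
    by rewrite /q1 /redirect eqxx (negPf cx).
  by rewrite eq_sym.
have qf : missed q f.
  move=> w; have [->|wc] := eqVneq w c; first by rewrite qc eq_sym.
  have [->|wx] := eqVneq w x; first by rewrite qx eq_sym.
  rewrite qE //; apply/eqP => pwf.
  have [[_ /eqP]|[_ /eqP]] := coll _ _ pwf wc; first by rewrite (negPf cx).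
  by rewrite eq_sym (negPf bc).
have pf : p f = d.
  have sq' : spare e q c f by rewrite (spare_sym e_sym).
  have cf : c != f by rewrite eq_sym.
  have [w wf] := spare_collides sel_q qf sq' cf.
  rewrite (qE f) //; have [->|wc] := eqVneq w c.
    by rewrite qc => /eqP; rewrite eq_sym (negPf (px f)).
  have [->|wx] := eqVneq w x; first by rewrite qx.
  rewrite qE // => pwf; have [[_ /eqP]|[/eqP]] := coll _ _ pwf wf.
    by rewrite (negPf fx).
  by rewrite (negPf wx).
have db : d != b by rewrite -pd eq_sym.
have fb : f != b.
  by apply/eqP => fb; have := dc; rewrite -pf fb pb eqxx.
pose s := [:: c; d; f; b; x].
have uniq_s : uniq s.
  rewrite /= !inE !negb_or [c == d]eq_sym dc [c == f]eq_sym fc [c == b]eq_sym bc.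
  by rewrite cx [d == f]eq_sym fd db dx fb fx bx.
have pc : p c = f by [].
have pxc : p x = c by [].
have pbc : p b = c by rewrite pb.
have sT : forall y, y \in s.
  suff sP : forall y, y \in [set y in s] by move=> y; have := sP y; rewrite inE.
  have c_s : c \in [set y in s] by rewrite !inE eqxx.
  apply: (closed_setT e_conn c_s) => y z ys eyz.
  have [<-|pyz] := eqVneq (p y) z.
    by move: ys; rewrite !inE => /or4P[|||/orP[]] /eqP->;
       rewrite ?pc ?pd ?pf ?pbc ?pxc ?eqxx ?orbT.
  have [pzy|pzy] := eqVneq (p z) y.
    have [w ws yE] : exists2 w, w \in s & y = p w.
      have yx : y != x by rewrite -pzy px.
      move: ys; rewrite !inE (negPf yx) orbF => /or4P[] /eqP->;
      [exists b | exists f | exists c | exists d];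
        by rewrite ?inE ?eqxx ?orbT.
    have [->|zw] := eqVneq z w; first by rewrite inE.
    have [[-> _]|[-> _]] := coll _ _ (etrans pzy yE) zw;
      by rewrite !inE eqxx ?orbT.
  have sp : spare e p y z by rewrite /spare eyz pyz pzy.
  have [yE|->] := spare_touches_missed sel_p px sp.
    by rewrite (spare_x_uniq z d) ?inE ?eqxx ?orbT // -yE.
  by rewrite !inE eqxx ?orbT.
(* Spare edges all meet [x], so elsewhere adjacency is read off [p]. *)
have nedge y z : y != x -> z != x -> p y != z -> p z != y -> e y z = false.
  move=> yx zx pyz pzy; apply/negP => eyz.
  have sp : spare e p y z by rewrite /spare eyz pyz pzy.
  by have [/eqP|/eqP] := spare_touches_missed sel_p px sp; apply/negP.
have ecf : e c f by rewrite e_sym (sel_p c).1.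
have ecb : e c b by rewrite -pbc (sel_p b).1.
have ecx : e c x by exact: (sel_p x).1.
have edf : e d f by rewrite -pf (sel_p f).1.
have edb : e d b by rewrite e_sym -pd (sel_p d).1.
have edx : e d x by rewrite e_sym; case/and3P: sp_xv1.
have ecd : e c d = false.
  by apply: nedge => //; rewrite ?pc ?pd.
have efb : e f b = false.
  by apply: nedge => //; rewrite ?pf ?pbc // eq_sym.
have nx y : y != x -> p y != x -> p x != y -> y != d -> e x y = false.
  move=> yx py pxy yd; apply/negP => exy; case/eqP: yd.
  by apply: spare_x_uniq => //; rewrite /spare exy pxy py.
have exf : e x f = false by apply: nx => //; rewrite pxc eq_sym.
have exb : e x b = false by apply: nx => //; rewrite ?pxc eq_sym.
have edges := (e_irr, ecf, ecb, ecx, edf, edb, edx, ecd, (efb, exf, exb),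
  (e_sym f c, e_sym b c, e_sym x c, e_sym f d, e_sym b d, e_sym x d),
  (e_sym d c, e_sym b f, e_sym f x, e_sym b x)).
constructor 2.
pose idx (z : 'I_2 + 'I_3) : nat :=
  match z with inl i => i | inr j => j + 2 end.
apply: (@graph_iso_seq _ _ _ _ c s idx) => //.
- case=> [i|i] [j|j] /=.
  + by move/val_inj->.
  + by move=> ij; have := ltn_ord i; rewrite ij addn2.
  + by move=> ij; have := ltn_ord j; rewrite -ij addn2.
  + by move/addIn/val_inj->.
- case=> i /=; first exact: ltn_trans (ltn_ord i) _.
  by rewrite addn2; exact: (ltn_ord i).
- by rewrite card_sum !card_ord.
by case=> -[[|[|[|//]]] ?] // [] [[|[|[|//]]] ?] //=; rewrite ?edges.
Qed.

(** The orbit of [x] under [p] is a tail running into a cycle. The end of the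
    cycle and the end of the tail form the unique colliding pair, so nothing
    outside the orbit is adjacent to it. *)
Lemma functional_family p x :
    selector e p -> missed p x -> (forall u v, ~~ spare e p u v) ->
  in_family_F e.
Proof.
move=> sel_p px nsp.
have eE u v : e u v = (p u == v) || (p v == u).
  apply/idP/idP => [euv|/orP[]/eqP<-]; last exact: (sel_p v).1.
    by have := nsp u v; rewrite /spare euv /= -negb_or negbK.
  by rewrite e_sym (sel_p u).1.
(* The orbit has [m] points, and its [m]-th iterate falls back to the [j]-th. *)
pose m := order p x; pose s := traject p x m.
have uniq_s : uniq s := orbit_uniq p x.
have it_s : forall i, iter i p x \in s by apply/loopingP; exact: looping_order.
have it_inj i i' : i < m -> i' < m -> (iter i p x == iter i' p x) = (i == i').
  move=> im im'; rewrite -!(nth_traject p im) -!(nth_traject p im') nth_uniq //.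
    by rewrite size_traject.
  by rewrite size_traject.
have /trajectP[j jm itm] := it_s m.
have m_gt0 : 0 < m by apply: leq_ltn_trans jm.
(* The tail is nonempty because [x] has no preimage. *)
have [j' jE] : exists j', j = j'.+1.
  case: j itm {jm} => [|j']; last by exists j'.
  by case: (m) m_gt0 => // m' _ /= /eqP; rewrite (negPf (px _)).
subst j.
have it_neq i i' : i < m -> i' < m -> i != i' -> iter i p x != iter i' p x.
  by move=> im im' ii'; rewrite it_inj.
(* The cycle is neither a loop nor a pair of opposite arcs. *)
have [k mE] : exists k, m = j'.+1 + k.+3.
  exists (m - j'.+4); suff: m != j'.+2 /\ m != j'.+3 by lia.
  split; apply/eqP => mE; move: itm; rewrite mE /= => /eqP; apply/negP.
    by case: (sel_p (p (iter j' p x))) => /(edge_neq e_irr).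
  by case: (sel_p (p (iter j' p x))).
have sT : forall y, y \in s.
  suff sP : forall y, y \in [set y in s] by move=> y; have := sP y; rewrite inE.
  have x_s : x \in [set y in s] by rewrite inE (it_s 0).
  apply: (closed_setT e_conn x_s) => y z; rewrite !inE => ys.
  have /trajectP[i im ->] := ys; rewrite eE => /orP[/eqP<-|].
    exact: (it_s i.+1).
  case: i {im} => [|i] /=; first by rewrite (negPf (px z)).
  move=> /eqP pz; have [->|zi] := eqVneq z (iter i p x); first exact: it_s.
  have pcoll : p (iter m.-1 p x) = p (iter j' p x).
    by rewrite -!iterS prednK.
  have neq_coll : iter m.-1 p x != iter j' p x by apply: it_neq; lia.
  by have [[-> _]|[-> _]] := collision_uniq sel_p pcoll neq_coll pz zi;
    exact: it_s.
(* The path index [j'.+1] is the cycle vertex where the tail enters. *)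
exists k.+3, j'.+2, ord0, ord_max; split=> //.
  apply/cards1P; exists (inord j'); apply/setP => y.
  by rewrite !inE /path_graph -val_eqE /= inordK //; have := ltn_ord y; lia.
pose idx (z : 'I_k.+3 + {y : 'I_j'.+2 | y != ord_max}) : nat :=
  match z with inl i => j'.+1 + i | inr y => val (val y) end.
have lt_y (y : {y : 'I_j'.+2 | y != ord_max}) : val (val y) < j'.+1.
  by case: y => y /=; rewrite -val_eqE /=; have := ltn_ord y; lia.
have lt_idx z : idx z < m.
  rewrite mE; case: z => [i|y] /=; last by have /= := lt_y y; lia.
  by have := ltn_ord i; lia.
have nth_s z : nth x s (idx z) = iter (idx z) p x by rewrite nth_traject.
pose succ i := if i.+1 == m then j'.+1 else i.+1.
have p_it i : i < m -> p (iter i p x) = iter (succ i) p x.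
  by rewrite /succ; case: eqP => [im _|//]; rewrite -itm -im.
have lt_succ i : i < m -> succ i < m by rewrite /succ; case: eqP; lia.
apply: (@graph_iso_seq _ _ _ _ x s idx) => //.
- case=> [i|y] [i'|y'] /=.
  + by move/addnI/val_inj->.
  + by have /= := lt_y y'; lia.
  + by have /= := lt_y y; lia.
  + by move/val_inj/val_inj->.
- by move=> z; rewrite size_traject.
- by rewrite size_traject card_sum card_sig cardC1 !card_ord mE; lia.
move=> y z; rewrite !nth_s eE !p_it // !it_inj ?lt_succ // /succ mE.
case: y z => [i|y] [i'|y'] /=.
- rewrite /cycle_graph -!val_eqE !val_ordS /=.
  have := ltn_ord i; have := ltn_ord i'; do 4!case: ifP; lia.
- rewrite /path_graph -!val_eqE /=; have := ltn_ord i; have /= := lt_y y'.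
  move: (nat_of_ord i) (nat_of_ord (sval y')) => i1 y1; do 2!case: ifP; lia.
- rewrite /path_graph -!val_eqE /=; have := ltn_ord i'; have /= := lt_y y.
  move: (nat_of_ord i') (nat_of_ord (sval y)) => i1 y1; do 2!case: ifP; lia.
- rewrite /path_graph /=; have /= := lt_y y; have /= := lt_y y'.
  move: (nat_of_ord (sval y)) (nat_of_ord (sval y')) => y1 y2.
  do 2!case: ifP; lia.
Qed.

End Tight.

(** * Functional graphs *)

(** A graph with as many edges as vertices leaves no freedom. The arcs of [q] and
    those of [p] give [#|T|] distinct edges each, hence the same edges. If
    [p w != q w], then [p] uses the edge between [w] and [u := q w] as
    [p u = w]; it must then use the edge between [u] and [q u] as [p (q u) = u],
    so [u] is in its image anyway. *)
Lemma functional_image (T : finType) (e : rel T) (p q : T -> T) :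
    functional e q -> selector e q -> selector e p ->
  q @: setT \subset p @: setT.
Proof.
move=> fun_q sel_q sel_p.
pose arcs (f : T -> T) := [set [set v; f v] | v : T].
have card_arcs f : selector e f -> #|arcs f| = #|T|.
  move=> sel_f; apply: card_imset => v w /eqP; rewrite set2_eq.
  case/orP=> /andP[/eqP vE /eqP wE] //.
  by have := (sel_f w).2; rewrite -vE wE eqxx.
have arcsE : arcs q = arcs p.
  apply/esym/eqP; rewrite eqEcard !card_arcs // leqnn andbT.
  apply/subsetP => _ /imsetP[v _ ->]; have := (sel_p v).1; rewrite fun_q.
  case/orP=> /eqP qE; apply/imsetP; last by exists v; rewrite ?qE.
  by exists (p v); rewrite // qE setUC.
have arc w : p w = q w \/ p (q w) = w.
  have : [set w; q w] \in arcs p by rewrite -arcsE; apply/imsetP; exists w.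
  case/imsetP => z _ /eqP; rewrite set2_eq.
  by case/orP=> /andP[/eqP-> /eqP->]; [left | right].
apply/subsetP => _ /imsetP[w _ ->]; apply/imsetP.
have [<-|pqw] := arc w; first by exists w.
have [pqw'|<-] := arc (q w); last by exists (q (q w)).
by have := (sel_q w).2; rewrite -pqw' pqw eqxx.
Qed.

(** * Invariance under isomorphism *)

Lemma dom_t_iso_leq (T1 T2 : finType) (e1 : rel T1) (e2 : rel T2) :
  symmetric e1 -> irreflexive e1 -> graph_iso e1 e2 -> dom_t e1 <= dom_t e2.
Proof.
move=> sym1 irr1 [f [g fK gK] eE].
have [lt_dom|] := ltnP (dom_t e2) #|T2|; last first.
  rewrite -(bij_eq_card (Bijective fK gK)); apply: leq_trans.
  exact: bigmin_leq_init.
have [p sel_p le_p] := dom_t_attained lt_dom.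
have sel1 : selector e1 (g \o p \o f).
  move=> v; rewrite /= gK -eE gK; split; first exact: (sel_p (f v)).1.
  by rewrite -(inj_eq (can_inj fK)) gK (sel_p (f v)).2.
apply: leq_trans (dom_t_leq sym1 irr1 sel1) (leq_trans _ le_p).
apply: leq_trans (leq_imset_card g (p @: setT)); apply/subset_leq_card/subsetP.
by move=> _ /imsetP[v _ ->] /=; rewrite !imset_f.
Qed.

Lemma dom_t_iso (T1 T2 : finType) (e1 : rel T1) (e2 : rel T2) :
  symmetric e1 -> irreflexive e1 -> graph_iso e1 e2 -> dom_t e1 = dom_t e2.
Proof.
move=> sym1 irr1 iso; apply/eqP; rewrite eqn_leq dom_t_iso_leq //=.
have [f [g fK gK] eE] := iso.
have e2E x y : e1 (g x) (g y) = e2 x y by rewrite -eE !gK.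
apply: dom_t_iso_leq.
- by move=> x y; rewrite -!e2E sym1.
- by move=> x; rewrite -e2E irr1.
by exists g => //; exists f.
Qed.

Lemma graph_iso_card (T1 T2 : finType) (e1 : rel T1) (e2 : rel T2) :
  graph_iso e1 e2 -> #|T1| = #|T2|.
Proof. by case=> f bij_f _; exact: bij_eq_card bij_f. Qed.

(** * The exceptional graphs *)

Lemma selector_image3 (T : finType) (e : rel T) (p : T -> T) (v : T) :
  irreflexive e -> selector e p -> 3 <= #|p @: setT|.
Proof.
move=> irr sel_p; apply/card_gt2P.
exists (p v), (p (p v)), (p (p (p v))); rewrite !imset_f //; split=> //.
have neq w : p w != w := edge_neq irr (sel_p w).1.
by split; rewrite ?(sel_p (p v)).2 // eq_sym.
Qed.

(** Iterates of [p] alternate between the sides, and two steps of [p] never come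
    back, so each side contains two distinct images. *)
Lemma selector_image4 (T : finType) (e : rel T) (p : T -> T) (side : pred T)
    (v : T) :
    (forall x y, e x y -> side x != side y) -> selector e p ->
  4 <= #|p @: setT|.
Proof.
move=> bip sel_p.
have sideE w : side (p w) = ~~ side w.
  by have /bip := (sel_p w).1; case: (side _); case: (side w).
pose s := [:: p v; p (p (p v)); p (p v); p (p (p (p v)))].
have side_neq x y : side x != side y -> x != y by apply: contraNneq => ->.
have uniq_s : uniq s.
  rewrite /= !inE !negb_or [p v == p (p (p v))]eq_sym (sel_p (p v)).2.
  rewrite [p (p v) == _]eq_sym (sel_p (p (p v))).2.
  by rewrite !side_neq // !sideE; case: (side v).
rewrite -[4]/(size s) -(card_uniqP uniq_s); apply/subset_leq_card/subsetP.
by move=> w; rewrite !inE => /or4P[] /eqP->; rewrite imset_f.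
Qed.

Lemma dom_t_eq (T : finType) (e : rel T) (p : T -> T) m :
    symmetric e -> irreflexive e -> selector e p -> #|p @: setT| <= m ->
    m <= #|T| -> (forall q, selector e q -> m <= #|q @: setT|) ->
  dom_t e = m.
Proof.
move=> sym irr sel_p le_p le_m ge_m; apply/eqP; rewrite eqn_leq dom_t_geq //.
by rewrite (leq_trans (dom_t_leq sym irr sel_p)).
Qed.

(** The triangle on 0, 1, 2 directed cyclically, with the vertex 3 hanging from 1;
    it avoids the edge between 0 and 3, so it serves both graphs on four
    vertices. *)
Definition tri_selector (i : 'I_4) : 'I_4 := inord (nth 1 [:: 1; 2; 0] i).

Lemma tri_selector_image : #|tri_selector @: setT| <= 3.
Proof.
have sub : tri_selector @: setT \subset [set inord 0; inord 1; inord 2].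
  apply/subsetP => _ /imsetP[[[|[|[|[|//]]]] ?] _ ->];
  by rewrite /tri_selector /= !inE eqxx ?orbT.
apply: leq_trans (subset_leq_card sub) _.
apply: leq_trans (leq_card_setU _ _) _; rewrite cards1 addn1 ltnS.
by rewrite cards2; case: (_ != _).
Qed.

Lemma dom_t_complete4 : dom_t (complete_graph 4) = 3.
Proof.
have irr : irreflexive (complete_graph 4).
  by move=> x; rewrite /complete_graph eqxx.
apply: (@dom_t_eq _ _ tri_selector) => //; last 2 first.
- by rewrite card_ord.
- by move=> q; apply: selector_image3 irr; exact: ord0.
- by move=> x y; rewrite /complete_graph eq_sym.
- by case=> -[|[|[|[|//]]]] i4;
    rewrite /complete_graph /tri_selector -!val_eqE /= !inordK.
exact: tri_selector_image.
Qed.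

Lemma dom_t_K4_minus_edge : dom_t K4_minus_edge = 3.
Proof.
have irr : irreflexive K4_minus_edge by move=> x; rewrite K4_minus_edgeE eqxx.
apply: (@dom_t_eq _ _ tri_selector) => //; last 2 first.
- by rewrite card_ord.
- by move=> q; apply: selector_image3 irr; exact: ord0.
- by move=> x y; rewrite !K4_minus_edgeE eq_sym; lia.
- by case=> -[|[|[|[|//]]]] i4;
    rewrite K4_minus_edgeE /tri_selector -!val_eqE /= !inordK.
exact: tri_selector_image.
Qed.

Lemma dom_t_complete_bipartite23 : dom_t (complete_bipartite 2 3) = 4.
Proof.
pose K := complete_bipartite 2 3.
pose side (z : 'I_2 + 'I_3) := if z is inl _ then true else false.
have bip x y : K x y -> side x != side y.
  by case: x y => ? [].
(* A directed 4-cycle; the remaining vertex hangs from [inl ord0]. *)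
pose p (z : 'I_2 + 'I_3) : 'I_2 + 'I_3 :=
  match z with
  | inl i => inr (inord i)
  | inr j => inl (if j == 0 :> nat then ord_max else ord0)
  end.
apply: (@dom_t_eq _ _ p) => //.
- by case=> ? [].
- by case.
- by case=> [[[|[|//]] ?]|[[|[|[|//]]] ?]] /=; split=> //;
    rewrite ?inordK //=; apply/eqP => -[/(congr1 val)] /=; rewrite ?inordK.
- have sub : p @: setT \subset
      [set inl ord0; inl ord_max; inr (inord 0); inr (inord 1)].
    apply/subsetP => _ /imsetP[[[[|[|//]] ?]|[[|[|[|//]]] ?]] _ ->] /=;
    by rewrite !inE eqxx ?orbT.
  apply: leq_trans (subset_leq_card sub) _.
  apply: leq_trans (leq_card_setU _ _) _; rewrite cards1 addn1 ltnS.
  apply: leq_trans (leq_card_setU _ _) _; rewrite cards1 addn1 ltnS.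
  by rewrite cards2; case: (_ != _).
- by rewrite card_sum !card_ord.
by move=> q; exact: selector_image4 (inl ord0) bip.
Qed.

(** * Cycles with a pendant path *)

Lemma path_leaf_end l (b : 'I_l) :
  leaf (path_graph l) b -> b = 0 :> nat \/ b.+1 = l.
Proof.
move=> /cards1P[z nbE].
have nb (y : 'I_l) : path_graph l b y -> y = z.
  by move=> by_; apply/set1P; rewrite -nbE inE.
have [|b0] := eqVneq (val b) 0; first by left.
have [|bl] := eqVneq b.+1 l; first by right.
have lt_l : b.+1 < l by rewrite ltn_neqAle bl ltn_ord.
have lt_p : b.-1 < l by rewrite (leq_ltn_trans (leq_pred b)) // ltn_ord.
have zS : Ordinal lt_l = z by apply: nb; rewrite /path_graph /= eqxx.
have zP : Ordinal lt_p = z.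
  by apply: nb; rewrite /path_graph /= prednK ?eqxx ?orbT // lt0n.
by have /(congr1 val) := etrans zS (esym zP); rewrite /=; lia.
Qed.

(** The neighbour of [y] in the direction of the leaf [b] is a cyclic shift, in one
    direction or the other according to which end [b] is. Treated as a
    permutation it wraps around at [b] only, so its value at [b] is the opposite
    end of the path. *)
Lemma path_towards_leaf l (b : 'I_l) :
    2 <= l -> leaf (path_graph l) b ->
  exists s s' : 'I_l -> 'I_l,
    [/\ cancel s s', cancel s' s,
      forall y y', path_graph l y y' =
        (y != b) && (s y == y') || (y' != b) && (s y' == y),
      s b != b & forall y, y != b -> s y != b -> s (s y) != y].
Proof.
move=> l2 /path_leaf_end leaf_b.
case: leaf_b => [b0|bl].
  exists (@ord_pred l), (@ordS l); split; [exact: ord_predK | exact: ordSK | | |].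
  - move=> y y'; rewrite /path_graph -!val_eqE !val_ord_pred /= b0.
    by have := ltn_ord y; have := ltn_ord y'; do 2!case: ifP; lia.
  - by rewrite -val_eqE val_ord_pred /= b0 eqxx; lia.
  - move=> y; rewrite -!val_eqE !val_ord_pred /= b0.
    by have := ltn_ord y; do 2!case: ifP; lia.
exists (@ordS l), (@ord_pred l); split; [exact: ordSK | exact: ord_predK | | |].
- move=> y y'; rewrite /path_graph -!val_eqE !val_ordS /=.
  by have := ltn_ord y; have := ltn_ord y'; do 2!case: ifP; lia.
- by rewrite -val_eqE val_ordS bl eqxx /=; lia.
- move=> y; rewrite -!val_eqE !val_ordS /=.
  by have := ltn_ord y; do 2!case: ifP; lia.
Qed.

(** The graph is functional: move around the cycle, and along the path towards
    it. The only vertex missed is the free end of the path. *)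
Lemma dom_t_identify k l (a : 'I_k) (b : 'I_l) :
    2 < k -> 1 < l -> leaf (path_graph l) b ->
  dom_t (identify (cycle_graph k) (path_graph l) a b) =
  #|{: 'I_k + {y : 'I_l | y != b}}| - 1.
Proof.
move=> k3 l2 leaf_b; set e := identify _ _ _ _.
have [s [s' [sK s'K pathE sb ss]]] := path_towards_leaf l2 leaf_b.
have inj_s : injective s := can_inj sK.
pose q (z : 'I_k + {y : 'I_l | y != b}) : 'I_k + {y : 'I_l | y != b} :=
  match z with
  | inl i => inl (ordS i)
  | inr y => if insub (s (val y)) is Some y' then inr y' else inl a
  end.
have q_inr y y' : (q (inr y) == inr y') = (s (val y) == val y').
  rewrite /q; case: insubP => [z _ <-|sy]; first by [].
  by symmetry; apply: contraNF sy => /eqP->; exact: (valP y').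
have q_inl y i : (q (inr y) == inl i) = (s (val y) == b) && (i == a).
  rewrite /q; case: insubP => [z sy _|]; first by rewrite (negPf sy).
  by rewrite negbK => -> /=; rewrite eq_sym.
have fun_q : functional e q.
  case=> [i|y] [j|z]; rewrite [LHS]/=.
  - by rewrite /cycle_graph [j == _]eq_sym [i == _]eq_sym.
  - by rewrite q_inl pathE eqxx (valP z) /= andbC.
  - by rewrite q_inl pathE eqxx (valP y) /= !orbF andbC.
  - by rewrite !q_inr pathE (valP y) (valP z).
have sym_e : symmetric e by move=> u v; rewrite !fun_q orbC.
have sel_q : selector e q.
  move=> v; split; first by rewrite fun_q eqxx orbT.
  case: v => [i|y].
    rewrite /= (inj_eq inl_inj) -val_eqE !val_ordS /=; have := ltn_ord i.
    by do 2!case: ifP; lia.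
  case qy: (q (inr y)) => [//|z]; rewrite q_inr.
  have /eqP <- : s (val y) == val z by rewrite -q_inr qy.
  apply: ss; first exact: (valP y).
  by have := qy; rewrite /q; case: insubP.
have irr_e : irreflexive e.
  move=> v; rewrite fun_q orbb; apply/negP => /eqP qv.
  by have := (sel_q v).2; rewrite !qv eqxx.
pose far : {y : 'I_l | y != b} := exist _ (s b) sb.
have q_far z : q z != inr far.
  case: z => [//|y]; rewrite q_inr (inj_eq inj_s); exact: (valP y).
have imq : q @: setT = [set~ inr far].
  apply/setP => z; rewrite !inE; apply/imsetP/idP => [[w _ ->] //|].
  case: z => [i|y] zf; first by exists (inl (ord_pred i)); rewrite //= ord_predK.
  have s'y : s' (val y) != b.
    apply: contra zf => /eqP s'y; apply/eqP; congr inr; apply: val_inj.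
    by rewrite -[LHS]s'K s'y.
  exists (inr (exist (fun y0 => y0 != b) _ s'y)) => //; apply/eqP.
  by rewrite eq_sym q_inr /= s'K.
have card_q : #|q @: setT| = #|{: 'I_k + {y : 'I_l | y != b}}| - 1.
  by rewrite imq cardsC1 subn1.
rewrite -card_q; apply: (@dom_t_eq _ _ q) => //; first exact: max_card.
by move=> p sel_p; apply/subset_leq_card/(functional_image fun_q).
Qed.

Theorem theorem5p4 (T : finType) (e : rel T)
    (e_sym : symmetric e) (e_irr : irreflexive e)
    (e_conn : connected e) (e_cyc : contains_cycle e) :
  dom_t e = #|T| - 1 <->
  in_family_F e \/
  [\/ graph_iso e (complete_graph 4),
      graph_iso e (complete_bipartite 2 3)
    | graph_iso e K4_minus_edge].
Proof.
have [T_gt0 conn] := e_conn; split.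
  move=> domE.
  have lt_dom : dom_t e < #|T| by rewrite domE; lia.
  have e_tight : tight e.
    by move=> p /(dom_t_leq e_sym e_irr); rewrite domE; lia.
  have [p sel_p le_p] := dom_t_attained lt_dom.
  have [x px] : exists x, x \notin p @: setT.
    apply/existsP; rewrite -negb_forall; apply/negP => /forallP pT.
    have : #|T| <= #|p @: setT|.
      by apply/subset_leq_card/subsetP => y _; exact: pT.
    by rewrite leqNgt (leq_ltn_trans le_p lt_dom).
  have {}px : missed p x by apply/missedP.
  have [/existsP[u /existsP[v sp]]|nsp] :=
    boolP [exists u, exists v, spare e p u v].
    by right; exact: (spare_selector e_sym e_irr e_tight conn sel_p px sp).
  left; apply: (functional_family e_sym e_irr e_tight conn sel_p px) => u v.
  by apply: contra nsp => sp; apply/existsP; exists u; apply/existsP; exists v.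
case=> [[k [l [a [b [k3 l2 leaf_b iso]]]]]|[] iso];
  rewrite (dom_t_iso e_sym e_irr iso) (graph_iso_card iso).
- exact: dom_t_identify.
- by rewrite dom_t_complete4 card_ord.
- by rewrite dom_t_complete_bipartite23 card_sum !card_ord.
- by rewrite dom_t_K4_minus_edge card_ord.
Qed.
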